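(* Let $0<p<1$, $q=1-p$, let $\theta\in[0,2\pi)$ with $\theta\ne\frac{n\pi}{2}$ for $n=0,1,2,3$, and let $M_n$ ($n=0,1,2,\dots$) denote the $n$-th moment of the probability distribution on $\mathbb{R}$ with characteristic function $$\varphi(\nu)=\frac{1}{2\pi}\int_0^{2\pi}e^{-\frac12\,\frac{1+2q\cos(k)+q^2}{1-q^2}\cot^2(\theta)\,\nu^2}\,dk .$$ Then for all $n=0,1,2,\dots$, $$M_{2n+1}=0,\qquad M_{2n}=\frac{(2n)!}{n!\,2^n}\Big(\frac{\cot^2\theta}{1-q^2}\Big)^nT_n(q),\qquad\text{where } T_n(q)=\sum_{l=0}^n\binom{n}{l}^2q^{2l}.$$
   Context: The distribution with characteristic function $\varphi$ arises as the limiting distribution, under the scaling $x\mapsto x/\sqrt t$, of the position of the decoherent quantum walk on $\mathbb{Z}$ with decoherence rate $p$ and coin operator $U\in O(2)$ given by $\begin{pmatrix}\cos\theta&-\sin\theta\\ \sin\theta&\cos\theta\end{pmatrix}$ or $\begin{pmatrix}\cos\theta&\sin\theta\\ \sin\theta&-\cos\theta\end{pmatrix}$. The characteristic function of a probability measure $\mu$ is $\varphi(\nu)=\int e^{i\nu x}\,d\mu(x)$, and its $n$-th moment is $\int x^n\,d\mu(x)$. *)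

(* Defs.v *)
From HB Require Import structures.
From mathcomp Require Import all_boot all_order all_algebra.
From mathcomp Require Import complex.
From mathcomp Require Import all_classical all_reals all_analysis.

Set Implicit Arguments.
Unset Strict Implicit.
Unset Printing Implicit Defensive.

Import Order.TTheory GRing.Theory Num.Theory.
Import numFieldNormedType.Exports.

Local Open Scope classical_set_scope.
Local Open Scope ring_scope.

Definition cot (R : realType) (x : R) : R := cos x / sin x.

(* Euler's formula: e^(i t) for real t. *)
Definition expi (R : realType) (t : R) : R[i] := Complex (cos t) (sin t).

(* Integral of a complex-valued function, taken on real and imaginary parts.
   Like [Rintegral], it is meaningful only when both parts are integrable. *)
Definition Cintegral (d : measure_display) (T : measurableType d)
    (R : realType) (mu : {measure set T -> \bar R}) (D : set T)
    (f : T -> R[i]) : R[i] :=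
  Complex (\int[mu]_(x in D) complex.Re (f x))
          (\int[mu]_(x in D) complex.Im (f x)).

Definition charfun (R : realType) (mu : probability (measurableTypeR R) R)
    (nu : R) : R[i] :=
  Cintegral mu setT (fun x : R => expi (nu * x)).

Definition moment_exists (R : realType)
    (mu : probability (measurableTypeR R) R) (n : nat) : Prop :=
  mu.-integrable setT (fun x : R => (x ^+ n)%:E).

(* For an integrand that is not integrable the value is a convention: to be
   read together with [moment_exists]. *)
Definition moment (R : realType) (mu : probability (measurableTypeR R) R)
    (n : nat) : \bar R :=
  (\int[mu]_x ((x : R) ^+ n)%:E)%E.

Definition phi (R : realType) (q theta nu : R) : R :=
  (2 * pi)^-1 *
  \int[lebesgue_measure]_(k in `[0, 2 * pi])
    expR (- (1 / 2) * ((1 + 2 * q * cos k + q ^+ 2) / (1 - q ^+ 2))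
          * cot theta ^+ 2 * nu ^+ 2).

Definition T_poly (R : realType) (n : nat) (q : R) : R :=
  \sum_(l < n.+1) 'C(n, l)%:R ^+ 2 * q ^+ (2 * l).

(* Main.v *)
(* Since [2 - 2 cos b] is the eigenvalue of the central difference of step [b]
   on [cos], the integral of [(2 - 2 cos (h x))^n] against [mu] is the [n]-fold
   iterated central difference of step [h] of the characteristic function at 0.
   Divided by [h^(2n)] the integrand increases at most to [x^(2n)] and tends to
   it as [h] tends to 0, so Fatou's lemma makes the even moments finite and
   dominated convergence computes them as limits of these difference quotients,
   without any uniqueness theorem for characteristic functions. The limit is
   read off the Taylor expansion of [phi] at 0, whose coefficients are the means
   over the circle of [(1 + 2 q cos k + q^2)^n = |1 + q e^(ik)|^(2n)], that is,
   [T_n(q)] by orthogonality of the characters. The same argument with [sin] in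
   place of [cos] kills the odd moments. *)

Require Import Defs.
From HB Require Import structures.
From mathcomp Require Import all_boot all_order all_algebra.
From mathcomp Require Import complex.
From mathcomp Require Import all_classical all_reals all_analysis.
From mathcomp Require Import measurable_realfun zify ring lra.
Import Order.TTheory GRing.Theory Num.Theory.
Import numFieldNormedType.Exports.
Set Implicit Arguments.
Unset Strict Implicit.
Unset Printing Implicit Defensive.
Local Open Scope classical_set_scope.
Local Open Scope ring_scope.

(** * Iterated central differences and their action on monomials *)

(** The sign is opposite to that of the usual second difference, so that the eigenvalue
    [2 - 2 cos b] on cosines and sines is nonnegative. *)
Definition central_diff (R : pzRingType) (h : R) (f : R -> R) (x : R) : R :=
  2 * f x - f (x - h) - f (x + h).

Lemma iter_central_diff_sum (R : comPzRingType) (h : R) (n m : nat)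
    (c : 'I_m -> R) (f : 'I_m -> R -> R) (x : R) :
  iter n (central_diff h) (fun y => \sum_(i < m) c i * f i y) x =
  \sum_(i < m) c i * iter n (central_diff h) (f i) x.
Proof.
elim: n x => [//|n IH] x; rewrite iterS /central_diff !IH mulr_sumr.
rewrite -!sumrB; apply: eq_bigr => i _; rewrite iterS /central_diff; ring.
Qed.

Lemma iter_central_diffD (R : comPzRingType) (h : R) (n : nat)
    (f g : R -> R) (x : R) :
  iter n (central_diff h) (fun y => f y + g y) x =
  iter n (central_diff h) f x + iter n (central_diff h) g x.
Proof.
by elim: n x => [//|n IH] x; rewrite !iterS /central_diff !IH; ring.
Qed.

Lemma iter_central_diff0 (R : comPzRingType) (h : R) (n : nat) (x : R) :
  iter n (central_diff h) (fun=> 0) x = 0.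
Proof.
by elim: n x => [//|n IH] x; rewrite iterS /central_diff !IH; ring.
Qed.

(** The coefficients 2, -1, -1 have absolute sum 4, and each difference reaches [h] further to both
    sides, so [n] of them see only the points within [n h] of [x]. *)
Lemma ler_norm_iter_central_diff (R : realDomainType) (h B : R) (n : nat)
    (f : R -> R) (x : R) : 0 <= h ->
  (forall y, `|y - x| <= n%:R * h -> `|f y| <= B) ->
  `|iter n (central_diff h) f x| <= 4 ^+ n * B.
Proof.
move=> h0; elim: n x => [|n IH] x fB.
  by rewrite expr0 mul1r; apply: fB; rewrite subrr normr0 mul0r.
have key z : `|z - x| <= h -> `|iter n (central_diff h) f z| <= 4 ^+ n * B.
  move=> zx; apply: IH => y yz; apply: fB.
  rewrite -natr1 mulrDl mul1r -(subrKA z).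
  exact: le_trans (ler_normD _ _) (lerD _ _).
rewrite iterS /central_diff exprS -mulrA.
have k0 := key x; rewrite subrr normr0 in k0.
have k1 := key (x - h); rewrite addrAC subrr add0r normrN ger0_norm // in k1.
have k2 := key (x + h); rewrite addrAC subrr add0r ger0_norm // in k2.
move: (k0 h0) (k1 (lexx _)) (k2 (lexx _)); rewrite !ler_norml.
move=> /andP[? ?] /andP[? ?] /andP[? ?]; apply/andP; split; lra.
Qed.

(** In the binomial expansions of [(x + h)^(m+2)] and [(x - h)^(m+2)] the terms of order 0 cancel
    against [2 x^(m+2)] and the odd orders cancel each other. Hence the degree drops by two; [i]
    indexes the order [i + 2] in [h]. *)
Lemma central_diffXn (R : comPzRingType) (h : R) (m : nat) (x : R) :
  central_diff h (fun y => y ^+ m.+2) x =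
  \sum_(i < m.+1) (- ('C(m.+2, i.+2)%:R * h ^+ i.+2 * (1 + (-1) ^+ i)))
    * x ^+ (m - i).
Proof.
have expand c : (x + c) ^+ m.+2 = x ^+ m.+2 + m.+2%:R * c * x ^+ m.+1 +
    \sum_(i < m.+1) 'C(m.+2, i.+2)%:R * c ^+ i.+2 * x ^+ (m - i).
  rewrite exprDn 2!big_ord_recl /= bin0 bin1 subn0 expr0 expr1 mulr1 mulr1n subn1 addrA.
  congr (_ + _ + _); first by rewrite -mulr_natr; ring.
  by apply: eq_bigr => i _; rewrite /bump !leq0n !add1n !subSS -mulr_natr; ring.
rewrite /central_diff !expand.
under [RHS]eq_bigr => i _ do rewrite mulNr mulrDr mulr1 mulrDl opprD.
rewrite big_split !sumrN /=.
rewrite (_ : \sum_(i < m.+1) _ * (-1) ^+ _ * _ =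
  \sum_(i < m.+1) 'C(m.+2, i.+2)%:R * (- h) ^+ i.+2 * x ^+ (m - i)); last first.
  by apply: eq_bigr => i _; rewrite [(- h) ^+ _]exprNn !exprS; ring.
ring.
Qed.

(** Each difference lowers the degree by two, so [n] of them kill every degree below [2n] and turn
    degree [2n] into a constant, the product of the leading coefficients [- 2j (2j - 1) h^2]. *)
Lemma iter_central_diffXn (R : comPzRingType) (h : R) (n m : nat) (x : R) :
  (m <= 2 * n)%N ->
  iter n (central_diff h) (fun y => y ^+ m) x =
  if m == (2 * n)%N then (-1) ^+ n * (2 * n)`!%:R * h ^+ (2 * n) else 0.
Proof.
elim: n m x => [|n IH] m x.
  by rewrite muln0 leqn0 => /eqP ->; rewrite /= !expr0 fact0 !mulr1.
rewrite iterSr mulnS => mn.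
have zero (f : R -> R) : (forall y, f y = 0) -> iter n (central_diff h) f x = 0.
  by move=> /funext ->; exact: iter_central_diff0.
case: m mn => [|[|m]] mn.
- by rewrite zero // => y; rewrite /central_diff !expr0; ring.
- by rewrite zero // => y; rewrite /central_diff !expr1; ring.
rewrite (_ : central_diff h _ = fun y => \sum_(i < m.+1)
   (- ('C(m.+2, i.+2)%:R * h ^+ i.+2 * (1 + (-1) ^+ i))) * y ^+ (m - i)).
  rewrite (iter_central_diff_sum _ _ _ (fun (i : 'I_m.+1) (y : R) => y ^+ (m - i))).
  have {}mn : (m <= 2 * n)%N by lia.
  rewrite [(_ == _)](_ : _ = (m == 2 * n)%N) ?[(2 + _)%N]add2n; last by apply/eqP/eqP; lia.
  (* Only the term [i = 0] keeps degree [m]; the others have degree below [2n] and vanish by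
     induction. *)
  rewrite big_ord_recl /= subn0 IH // big1 ?addr0.
    case: eqP => [->|_]; last by rewrite mulr0.
    rewrite factS (factS (2 * n)) !natrM !exprS.
    (* This gives [2 C(2n+2, 2) = (2n+2)(2n+1)], the two new factors of the factorial. *)
    have := congr1 (fun k => k%:R : R) (mul_bin_diag (2 * n).+2 1).
    rewrite bin1 !natrM /= => bin.
    rewrite (_ : _ * (1 + 1) = 2%:R * 'C((2 * n).+2, 2)%:R * (h * h)); last ring.
    by rewrite -bin; ring.
  move=> i _; rewrite IH; last by rewrite (leq_trans (leq_subr _ _)).
  by rewrite ifF ?mulr0 //; apply/negP => /eqP; have := ltn_ord i; rewrite /bump leq0n add1n; lia.
by apply/funext => y; exact: central_diffXn.
Qed.

(** * Taylor remainders of the exponential *)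

(* [(-1)^n] times the remainder after [n] terms of the Taylor series of
   [exp (- y)]: each remainder is the derivative of the next one, and they are
   nonnegative for [y >= 0]. *)
Fixpoint expRN_rem (R : realType) (n : nat) (y : R) : R :=
  if n is m.+1 then y ^+ m / m`!%:R - expRN_rem m y else expR (- y).

Lemma is_derive_expRN_rem (R : realType) (n : nat) (y : R) :
  is_derive y 1 (expRN_rem n.+1) (expRN_rem n y).
Proof.
elim: n => [|n IH].
  rewrite (_ : expRN_rem 1 = fun z : R => 1 - expR (- z)); last first.
    by apply/funext => z /=; rewrite expr0 fact0 divr1.
  by apply: is_derive_eq; rewrite /= /GRing.scale /=; ring.
have dX : is_derive y 1 (fun z : R => z ^+ n.+1 / n.+1`!%:R) (y ^+ n / n`!%:R).
  rewrite (_ : (fun z => _) = (n.+1`!%:R)^-1 \*: (@id R ^+ n.+1)).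
    apply: is_derive_eq; rewrite /GRing.scale /= factS natrM.
    by field; rewrite nat1r !pnatr_eq0 -lt0n fact_gt0.
  by apply/funext => z; rewrite /= exprfctE /GRing.scale /= mulrC.
exact: is_deriveB dX IH.
Qed.

(** For positive index the remainder vanishes at 0 and has a nonnegative derivative by induction, so
    it is nondecreasing on the half-line. *)
Lemma expRN_rem_ge0 (R : realType) (n : nat) (y : R) : 0 <= y -> 0 <= expRN_rem n y.
Proof.
elim: n y => [|n IH] y y0; first exact: expR_ge0.
have <- : expRN_rem n.+1 (0:R) = 0.
  elim: {IH} n => [|n IH]; first by rewrite /= oppr0 expR0 expr0 fact0; field.
  by rewrite -{}[RHS]oppr0 -[in RHS]IH /= exprS mul0r mul0r sub0r.
apply: (@ger0_derive1_ndecry _ (expRN_rem n.+1) 0) => //.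
- by move=> x _; case: (is_derive_expRN_rem n x).
- move=> x; rewrite in_itv /= andbT => x0.
  by rewrite derive1E (@derive_val _ _ _ _ _ _ _ (is_derive_expRN_rem n x)) IH // ltW.
- apply: continuous_subspaceT => x. apply: differentiable_continuous.
  by apply/derivable1_diffP; case: (is_derive_expRN_rem n x).
Qed.

(** The difference of the two sides is the next remainder. *)
Lemma expRN_rem_le (R : realType) (n : nat) (y : R) :
  0 <= y -> expRN_rem n y <= y ^+ n / n`!%:R.
Proof. by move=> /(@expRN_rem_ge0 R n.+1 y); rewrite /= subr_ge0. Qed.

Lemma continuous_expRN_rem (R : realType) (n : nat) :
  continuous (@expRN_rem R n.+1).
Proof.
move=> x; apply: differentiable_continuous.
by apply/derivable1_diffP; case: (is_derive_expRN_rem n x).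
Qed.

(** * Means over the circle and the Taylor expansion of a mean of Gaussians *)

Definition circle_mean (R : realType) (f : R -> R) : R :=
  (2 * pi)^-1 * \int[lebesgue_measure]_(k in `[0, 2 * pi]) f k.

Lemma integrable_circle (R : realType) (f : R -> R) : continuous f ->
  lebesgue_measure.-integrable `[0, 2 * pi] (EFin \o f).
Proof.
move=> cf; apply: continuous_compact_integrable; first exact: segment_compact.
exact: continuous_subspaceT.
Qed.

Lemma circle_meanD (R : realType) (f g : R -> R) :
  continuous f -> continuous g ->
  circle_mean (fun k => f k + g k) = circle_mean f + circle_mean g.
Proof.
move=> cf cg; rewrite /circle_mean RintegralD //; [exact: mulrDr|exact: integrable_circle..].
Qed.

Lemma circle_meanZl (R : realType) (c : R) (f : R -> R) :
  continuous f -> circle_mean (fun k => c * f k) = c * circle_mean f.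
Proof.
move=> cf; rewrite /circle_mean RintegralZl //; [exact: mulrCA|exact: integrable_circle].
Qed.

Lemma continuous_sum (R : numFieldType) (T : topologicalType) (n : nat)
    (f : 'I_n -> T -> R) :
  (forall i, continuous (f i)) -> continuous (fun x => \sum_(i < n) f i x).
Proof.
elim: n f => [|n IH] f cf x.
  rewrite (_ : (fun y => _) = cst 0); first exact: cvg_cst.
  by apply/funext => y; rewrite big_ord0.
rewrite (_ : (fun y => _) = fun y => f ord0 y + \sum_(i < n) f (lift ord0 i) y).
  by apply: cvgD; [exact: cf|apply: IH => i; exact: cf].
by apply/funext => y; rewrite big_ord_recl.
Qed.

Lemma circle_mean_sum (R : realType) (n : nat) (f : 'I_n -> R -> R) :
  (forall i, continuous (f i)) ->
  circle_mean (fun k => \sum_(i < n) f i k) = \sum_(i < n) circle_mean (f i).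
Proof.
elim: n f => [|n IH] f cf.
  rewrite big_ord0 (_ : (fun k => _) = fun k => 0 * cst 0 k).
    by rewrite circle_meanZl ?mul0r // => x; exact: cvg_cst.
  by apply/funext => y; rewrite big_ord0 mul0r.
rewrite big_ord_recl -IH // -circle_meanD //; last exact: continuous_sum.
by congr circle_mean; apply/funext => y; rewrite big_ord_recl.
Qed.

Lemma ler_circle_mean (R : realType) (f g : R -> R) :
  continuous f -> continuous g -> (forall k, f k <= g k) ->
  circle_mean f <= circle_mean g.
Proof.
move=> cf cg fg; apply: ler_wpM2l; first by rewrite invr_ge0 mulr_ge0 // pi_ge0.
by apply: le_Rintegral => //; exact: integrable_circle.
Qed.

Lemma circle_mean_ge0 (R : realType) (f : R -> R) :
  (forall k, 0 <= f k) -> 0 <= circle_mean f.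
Proof.
move=> f0; apply: mulr_ge0; first by rewrite invr_ge0 mulr_ge0 // pi_ge0.
by apply: Rintegral_ge0 => k _.
Qed.

(** Averaging over [k] the expansion of [exp (- y)] at [y = b k * nu^2]: since [y] is nonnegative,
    the error is pointwise at most the first omitted term, and so is its mean. *)
Lemma circle_mean_expR (R : realType) (b : R -> R) (n : nat) (nu : R) :
  continuous b -> (forall k, 0 <= b k) ->
  let c j := circle_mean (fun k => b k ^+ j) / j`!%:R in
  exists2 r, `|r| <= c n * nu ^+ (2 * n) &
  circle_mean (fun k => expR (- (b k * nu ^+ 2))) =
    \sum_(j < n) (-1) ^+ j * c j * nu ^+ (2 * j) + r.
Proof.
move=> cb b0 c.
have cbX j : continuous (fun k => b k ^+ j).
  by move=> x; exact: (continuous_comp (cb x) (@exprn_continuous R j (b x))).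
have cbnu : continuous (fun k => b k * nu ^+ 2).
  by move=> x; apply: cvgM; [exact: cb|exact: cvg_cst].
have ce : continuous (fun k => expR (- (b k * nu ^+ 2))).
  move=> x; apply: (@continuous_comp _ _ _ (fun k => - (b k * nu ^+ 2))).
    exact: cvgN (cbnu x).
  exact: continuous_expR.
have crem j : continuous (fun k => expRN_rem j (b k * nu ^+ 2)).
  case: j => [//|j] x; exact: (continuous_comp (cbnu x) (@continuous_expRN_rem R j _)).
have bnu0 k : 0 <= b k * nu ^+ 2 by rewrite mulr_ge0 ?sqr_ge0.
have cE j : c j * nu ^+ (2 * j) =
    circle_mean (fun k => (nu ^+ (2 * j) / j`!%:R) * b k ^+ j).
  by rewrite circle_meanZl // /c; ring.
exists ((-1) ^+ n * circle_mean (fun k => expRN_rem n (b k * nu ^+ 2))).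
  rewrite normrM normrX normrN1 expr1n mul1r ger0_norm; last first.
    by apply: circle_mean_ge0 => k; exact: expRN_rem_ge0.
  rewrite cE; apply: ler_circle_mean => //.
    by move=> x; apply: cvgM; [exact: cvg_cst|exact: cbX].
  move=> k; rewrite [leRHS](_ : _ = (b k * nu ^+ 2) ^+ n / n`!%:R).
    exact: expRN_rem_le.
  by rewrite exprMn exprM; ring.
(* The recursion defining [expRN_rem] moves one term at a time from the remainder into the sum. *)
elim: n => [|n IH]; first by rewrite big_ord0 add0r mul1r.
rewrite big_ord_recr /= IH -!addrA; congr (_ + _).
rewrite -mulrA cE [(-1) ^+ n.+1]exprS mulN1r mulNr -mulrBr; congr (_ * _).
apply/esym/eqP; rewrite subr_eq -circle_meanD //.
  by apply/eqP; congr circle_mean; apply/funext => k /=; rewrite exprMn exprM; ring.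
exact: (crem n.+1).
Qed.

(** * Orthogonality of characters and the polynomials [T_n] *)

Lemma continuous_scale (R : realType) (g : R -> R) (m : R) :
  continuous g -> continuous (fun k : R => g (m * k)).
Proof.
move=> cg x; apply: (@continuous_comp _ _ _ (fun k => m * k)); last exact: cg.
by apply: cvgM; [exact: cvg_cst|exact: cvg_id].
Qed.

(** For [l] and [j] distinct, the primitive [sin (m k) / m] with [m = l - j] vanishes at both ends
    of the period. *)
Lemma circle_mean_cos (R : realType) (l j : nat) :
  circle_mean (fun k : R => cos ((l%:R - j%:R) * k)) = (l == j)%:R.
Proof.
have pi2 : 0 < 2 * pi :> R by rewrite mulr_gt0 ?pi_gt0.
rewrite /circle_mean; have [->|lj] := eqVneq l j.
  under eq_Rintegral do rewrite subrr mul0r cos0.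
  rewrite Rintegral_cst //= lebesgue_measure_itv /= lte_fin pi2 oppr0 adde0 /=.
  by rewrite mul1r mulVf // gt_eqF.
set m : R := l%:R - j%:R.
have m0 : m != 0 by rewrite subr_eq0 eqr_nat.
(* Periodicity is applied to natural multiples only; as [m] may be negative, the subtraction formula
   for [sin] reduces to these. *)
have sin_nat (a : nat) : sin (a%:R * (2 * pi)) = 0 :> R.
  have E (w : R) : a%:R * (2 * w) = 0 + w *+ 2 *+ a.
    by rewrite add0r -mulrnA -[RHS]mulr_natr natrM; ring.
  by rewrite E (periodicn (@sinD2pi R)) sin0.
have dF (x : R) : is_derive x 1 (fun k => sin (m * k) / m) (cos (m * x)).
  apply: is_derive_eq; rewrite /GRing.scale /=; by field.
have cF : continuous (fun k : R => sin (m * k) / m).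
  by move=> x; apply: differentiable_continuous; apply/derivable1_diffP; case: (dF x).
rewrite /Rintegral (@continuous_FTC2 _ _ (fun k => sin (m * k) / m)) //=.
- have ->: sin (m * (2 * pi)) = 0 by rewrite mulrBl sinB !sin_nat mul0r mulr0 subr0.
  by rewrite mulr0 sin0 !mul0r subrr mulr0.
- by apply: continuous_subspaceT; exact: (@continuous_scale R cos m (@continuous_cos R)).
- split; first by move=> x _; case: (dF x).
  + exact/cvg_at_right_filter/cF.
  + exact/cvg_at_left_filter/cF.
- by move=> x _; rewrite derive1E (@derive_val _ _ _ _ _ _ _ (dF x)).
Qed.

Lemma expi_exp (R : realType) (l : nat) (k : R) : expi k ^+ l = expi (l%:R * k).
Proof.
elim: l => [|l IH]; first by rewrite expr0 mul0r /expi cos0 sin0.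
by rewrite exprS IH -nat1r mulrDl mul1r /expi cosD sinD /=; congr Complex; ring.
Qed.

Lemma sum_Complex (R : rcfType) (n : nat) (a b : 'I_n -> R) :
  \sum_(i < n) Complex (a i) (b i) = Complex (\sum_(i < n) a i) (\sum_(i < n) b i).
Proof.
elim: n a b => [|n IH] a b; first by rewrite !big_ord0.
by rewrite !big_ord_recr /= IH.
Qed.

(* [|1 + q e^(ik)|^(2n)], expanded by the binomial theorem. *)
Lemma poisson_factor_expand (R : realType) (q k : R) (n : nat) :
  (1 + 2 * q * cos k + q ^+ 2) ^+ n =
  \sum_(l < n.+1) \sum_(j < n.+1) ('C(n, l)%:R * q ^+ l) * ('C(n, j)%:R * q ^+ j)
     * cos ((l%:R - j%:R) * k).
Proof.
(* The squared modulus, real-valued and multiplicative. *)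
pose N (z : R[i]) : R := complex.Re z ^+ 2 + complex.Im z ^+ 2.
have NM (z w : R[i]) : N (z * w) = N z * N w.
  by case: z w => [a b] [c d]; rewrite /N /=; ring.
have NX (z : R[i]) m : N (z ^+ m) = N z ^+ m.
  elim: m => [|m IH]; first by rewrite /N /= expr1n expr0n /= addr0.
  by rewrite !exprS NM IH.
have {1}-> : 1 + 2 * q * cos k + q ^+ 2 = N (1 + Complex q 0 * expi k).
  transitivity (1 + 2 * q * cos k + q ^+ 2 * (cos k ^+ 2 + sin k ^+ 2)).
    by rewrite cos2Dsin2 mulr1.
  by rewrite /N /=; ring.
rewrite -NX exprDn.
under eq_bigr => i _.
  rewrite expr1n mul1r exprMn expi_exp.
  rewrite (_ : Complex q 0 ^+ i = Complex (q ^+ i) 0); last first.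
    by elim: (nat_of_ord i) => [//|m IH]; rewrite !exprS IH /=; congr Complex; ring.
  rewrite (_ : _ *+ _ = Complex ('C(n, i)%:R * q ^+ i * cos (i%:R * k))
     ('C(n, i)%:R * q ^+ i * sin (i%:R * k))); first over.
  elim: 'C(n, i) => [|m IH]; first by rewrite !mul0r mulr0n.
  by rewrite mulrS IH -nat1r /=; congr Complex; ring.
rewrite sum_Complex /N /= !expr2 !mulr_suml -big_split; apply: eq_bigr => l _ /=.
rewrite !mulr_sumr -big_split; apply: eq_bigr => j _ /=.
(* The squares of the real and imaginary parts give products of cosines and of sines, which the
   subtraction formula merges. *)
rewrite mulrBl cosB; ring.
Qed.

(** By orthogonality only the diagonal [l = j] of the double sum survives. *)
Lemma circle_mean_poisson_factor (R : realType) (q : R) (n : nat) :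
  circle_mean (fun k => (1 + 2 * q * cos k + q ^+ 2) ^+ n) = T_poly n q.
Proof.
rewrite (funext (fun k => poisson_factor_expand q k n)).
have ccos (l j : nat) : continuous (fun k : R => cos ((l%:R - j%:R) * k)).
  exact: (@continuous_scale R cos _ (@continuous_cos R)).
rewrite circle_mean_sum /T_poly; last first.
  move=> l; apply: continuous_sum => j x.
  by apply: cvgM; [exact: cvg_cst|exact: ccos].
apply: eq_bigr => l _; rewrite circle_mean_sum; last first.
  by move=> j x; apply: cvgM; [exact: cvg_cst|exact: ccos].
rewrite (bigD1 l) //= big1 ?addr0; last first.
  move=> j jl; rewrite circle_meanZl // circle_mean_cos.
  by rewrite (_ : (_ == _ :> nat) = false) ?mulr0 //; apply/negbTE; rewrite eq_sym.
by rewrite circle_meanZl // circle_mean_cos eqxx mulr1 mul2n -addnn exprD; ring.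
Qed.

(** * Bounds and limits for [sin] and [2 - 2 cos] *)

Lemma ler_norm_sin (R : realType) (y : R) : `|sin y| <= `|y|.
Proof.
(* The function [t - s sin t] is nondecreasing when [|s| <= 1]; [s = 1] and [s = -1] give the two
   bounds. *)
have sin_le (s x : R) : `|s| <= 1 -> 0 <= x -> s * sin x <= x.
  move=> s1 x0; rewrite -subr_ge0.
  have dF (z : R) : is_derive z 1 (fun t => t - s * sin t) (1 - s * cos z).
    by apply: is_derive_eq; rewrite /GRing.scale /=; ring.
  have -> : 0 = 0 - s * sin 0 :> R by rewrite sin0; ring.
  apply: (@ger0_derive1_ndecry _ (fun t => t - s * sin t) 0) => //.
  - move=> z _; rewrite derive1E (@derive_val _ _ _ _ _ _ _ (dF z)) subr_ge0.
    by rewrite (le_trans (ler_norm _)) // normrM mulr_ile1 // cos_max.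
  - apply: continuous_subspaceT => z; apply: differentiable_continuous.
    by apply/derivable1_diffP; case: (dF z).
have sin_norm (x : R) : 0 <= x -> `|sin x| <= x.
  move=> x0; rewrite ler_norml; apply/andP; split.
    by rewrite lerNl -mulN1r sin_le // normrN1.
  by rewrite -[leLHS]mul1r sin_le // normr1.
have [y0|y0] := leP 0 y; first by rewrite (ger0_norm y0) sin_norm.
by rewrite -normrN -sinN (ltr0_norm y0) sin_norm // oppr_ge0 ltW.
Qed.

(** The half-angle formula: it reduces sign, upper bound and limit of [2 - 2 cos] to facts about
    [sin]. *)
Lemma subr_2cos (R : realType) (y : R) : 2 - 2 * cos y = (2 * sin (y / 2)) ^+ 2.
Proof.
have {1}-> : y = (y / 2) *+ 2 by rewrite -mulr_natr divfK.
by rewrite cos_mulr2n cos2sin2; ring.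
Qed.

Lemma subr_2cos_ge0 (R : realType) (y : R) : 0 <= 2 - 2 * cos y.
Proof. by rewrite subr_2cos sqr_ge0. Qed.

Lemma subr_2cos_le (R : realType) (y : R) : 2 - 2 * cos y <= y ^+ 2.
Proof.
have {2}-> : y = 2 * (y / 2) by field.
rewrite subr_2cos 2!exprMn; apply: ler_wpM2l; first exact: exprn_ge0.
rewrite -[leLHS]real_normK ?num_real // -[leRHS]real_normK ?num_real //.
by rewrite lerXn2r ?nnegrE // ler_norm_sin.
Qed.

(** This is the derivative of [sin (t x)] at [t = 0], taken along the positive null sequence
    [1 / (m + 1)], because Fatou's lemma and dominated convergence are applied to sequences. *)
Lemma cvg_sin_harmonic (R : realType) (x : R) :
  sin (harmonic m * x) / harmonic m @[m --> \oo] --> x.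
Proof.
have dF : is_derive (0 : R) 1 (fun t : R => sin (t * x)) x.
  by apply: is_derive_eq; rewrite /GRing.scale /= mul0r cos0; ring.
have dlim := @derive_val _ _ _ _ _ _ _ dF.
have lim0 : sin (h * x) / h @[h --> 0^'] --> x.
  rewrite (_ : (fun h => _) = fun h => h^-1 *:
      (((fun t : R => sin (t * x)) \o shift 0) (h *: (1 : R)) - sin (0 * x))).
    by rewrite -[X in _ --> X]dlim; case: dF => dF _; exact: dF.
  by apply/funext => h; rewrite /= addr0 /GRing.scale /= mulr1 mul0r sin0 subr0 mulrC.
apply: ((cvgr_dnbhsP _ _ _).1 lim0 harmonic); split; last exact: cvg_harmonic.
by move=> m; rewrite gt_eqF //= invr_gt0.
Qed.

Lemma cvg_subr_2cos_harmonic (R : realType) (x : R) :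
  (2 - 2 * cos (harmonic m * x)) / harmonic m ^+ 2 @[m --> \oo] --> x ^+ 2.
Proof.
rewrite (_ : (fun m => _) = fun m => 2 * (sin (harmonic m * (x / 2)) / harmonic m)
  * (2 * (sin (harmonic m * (x / 2)) / harmonic m))); last first.
  apply/funext => m; rewrite subr_2cos -[_ * x / 2]mulrA -exprVn.
  by move: (sin _) (harmonic m)^-1 => s k; ring.
have -> : x ^+ 2 = 2 * (x / 2) * (2 * (x / 2)) by field.
by apply: cvgM; apply: cvgMr; exact: cvg_sin_harmonic.
Qed.

Lemma continuous_expn_subr_2cos (R : realType) (h : R) (n : nat) :
  continuous (fun x : R => (2 - 2 * cos (h * x)) ^+ n).
Proof.
move=> x; apply: (@continuous_comp _ _ _ (fun x => 2 - 2 * cos (h * x)) (fun y => y ^+ n));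
  last exact: exprn_continuous.
apply: cvgB; first exact: cvg_cst.
by apply: cvgM; [exact: cvg_cst|exact: (@continuous_scale R cos _ (@continuous_cos R))].
Qed.

(** * Central differences of the characteristic function as integrals *)

Lemma integrable_bounded_continuous (R : realType)
    (mu : probability (measurableTypeR R) R) (f : R -> R) (B : R) :
  continuous f -> (forall x, `|f x| <= B) -> mu.-integrable setT (EFin \o f).
Proof.
move=> cf fB; apply: measurable_bounded_integrable => //.
- exact: le_lt_trans (probability_le1 mu measurableT) (ltry _).
- exact: continuous_measurable_fun.
- exists B; split; first exact: num_real.
  by move=> y By x _; apply: (le_trans (fB x)); exact: ltW.
Qed.

(* [g] is [cos] or [sin]: an eigenfunction of every central difference. *)
Lemma iter_central_diff_Rintegral (R : realType)
    (mu : probability (measurableTypeR R) R) (g : R -> R) (h : R) (n : nat) (nu : R) :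
  continuous g -> (forall y, `|g y| <= 1) ->
  (forall a b, 2 * g a - g (a - b) - g (a + b) = (2 - 2 * cos b) * g a) ->
  iter n (central_diff h) (fun nu => \int[mu]_x g (nu * x)) nu =
  \int[mu]_x ((2 - 2 * cos (h * x)) ^+ n * g (nu * x)).
Proof.
move=> cg g1 eig.
have int m v : mu.-integrable setT
    (EFin \o (fun x => (2 - 2 * cos (h * x)) ^+ m * g (v * x))).
  apply: (@integrable_bounded_continuous _ _ _ (4 ^+ m)).
    move=> x; apply: cvgM; first exact: continuous_expn_subr_2cos.
    exact: continuous_scale.
  move=> x; rewrite normrM -[leRHS]mulr1; apply: ler_pM => //.
  rewrite normrX lerXn2r ?nnegrE // ger0_norm ?subr_2cos_ge0 //.
  by have := cos_geN1 (h * x); lra.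
elim: n nu => [|n IH] nu.
  by apply: eq_Rintegral => x _; rewrite expr0 mul1r.
have int2 m v : mu.-integrable setT
    (EFin \o (fun x => 2 * ((2 - 2 * cos (h * x)) ^+ m * g (v * x)))).
  by have := integrableZl measurableT 2 (int m v); apply: eq_integrable.
have intB m v w : mu.-integrable setT (EFin \o (fun x =>
    2 * ((2 - 2 * cos (h * x)) ^+ m * g (v * x)) - (2 - 2 * cos (h * x)) ^+ m * g (w * x))).
  by have := integrableB measurableT (int2 m v) (int m w); apply: eq_integrable.
rewrite iterS /central_diff !IH.
rewrite -(RintegralZl _ measurableT (int n nu)).
rewrite -(RintegralB measurableT (int2 n nu) (int n (nu - h))).
rewrite -(RintegralB measurableT (intB n nu (nu - h)) (int n (nu + h))).
apply: eq_Rintegral => x _.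
(* The eigenvalue identity at [nu * x] with step [h * x] supplies one more factor. *)
rewrite exprS -mulrA [RHS]mulrCA -eig [(nu + h) * x]mulrDl [(nu - h) * x]mulrBl; ring.
Qed.

(** * Moments from central differences *)

Lemma even_moment_of_central_diff (R : realType)
    (mu : probability (measurableTypeR R) R) (n : nat) (c : R) :
  iter n (central_diff (harmonic m)) (fun nu => \int[mu]_x cos (nu * x)) 0
    / harmonic m ^+ (2 * n) @[m --> \oo] --> c ->
  moment_exists mu (2 * n) /\ moment mu (2 * n) = c%:E.
Proof.
move=> limc.
pose f (m : nat) (x : measurableTypeR R) : R :=
  ((2 - 2 * cos (harmonic m * x)) / harmonic m ^+ 2) ^+ n.
have f0 m x : 0 <= f m x.
  by rewrite exprn_ge0 // divr_ge0 ?subr_2cos_ge0 // sqr_ge0.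
have hp m : 0 < harmonic m :> R by rewrite /= invr_gt0.
have fX m x : f m x <= x ^+ (2 * n).
  rewrite exprM lerXn2r ?nnegrE ?sqr_ge0 //.
    by rewrite divr_ge0 ?subr_2cos_ge0 // sqr_ge0.
  by rewrite ler_pdivrMr ?exprn_gt0 // [leRHS]mulrC -exprMn subr_2cos_le.
have fE m : f m = fun x => (harmonic m ^+ (2 * n))^-1 * (2 - 2 * cos (harmonic m * x)) ^+ n.
  by apply/funext => x; rewrite /f expr_div_n exprM mulrC.
have cf m : continuous (f m).
  rewrite fE => x; apply: cvgM; first exact: cvg_cst.
  exact: continuous_expn_subr_2cos.
have mf m : measurable_fun setT (fun x => (f m x)%:E).
  by apply/measurable_EFinP; exact: continuous_measurable_fun.
have flim x : (f m x)%:E @[m --> \oo] --> (x ^+ (2 * n))%:E.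
  apply: cvg_EFin; first by near=> m.
  rewrite exprM; apply: (@cvg_comp _ _ _ _ (fun y => y ^+ n)).
    exact: cvg_subr_2cos_harmonic.
  exact: exprn_continuous.
have intK m : mu.-integrable setT (EFin \o (fun x => (2 - 2 * cos (harmonic m * x)) ^+ n)).
  apply: (@integrable_bounded_continuous _ _ _ (4 ^+ n)).
    exact: continuous_expn_subr_2cos.
  move=> x; rewrite normrX lerXn2r ?nnegrE // ger0_norm ?subr_2cos_ge0 //.
  by have := cos_geN1 (harmonic m * x); lra.
(* At [nu = 0] the factor [cos (nu * x)] is 1, which leaves the power of [2 - 2 cos]. *)
have If m : (\int[mu]_x (f m x)%:E)%E =
    (iter n (central_diff (harmonic m)) (fun nu => \int[mu]_x cos (nu * x)) 0
    / harmonic m ^+ (2 * n))%:E.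
  rewrite iter_central_diff_Rintegral; last 3 first.
  - exact: continuous_cos.
  - exact: cos_max.
  - by move=> a b; rewrite cosB cosD; ring.
  under eq_Rintegral do rewrite mul0r cos0 mulr1.
  rewrite mulrC -RintegralZl // /Rintegral fineK.
    by apply: eq_integral => x _; rewrite fE.
  apply: integrable_fin_num => //.
  exact: (@integrableZl _ _ _ _ _ measurableT _ _ (intK m)).
have Iflim : (\int[mu]_x (f m x)%:E)%E @[m --> \oo] --> c%:E.
  by under eq_fun do rewrite If; apply: cvg_EFin => //; near=> m.
have mX : measurable_fun setT (fun x : measurableTypeR R => (x ^+ (2 * n))%:E).
  by apply/measurable_EFinP; exact: continuous_measurable_fun (@exprn_continuous R _).
have X0 (x : R) : 0 <= x ^+ (2 * n) by rewrite exprM exprn_ge0 // sqr_ge0.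
have intX : moment_exists mu (2 * n).
  apply/integrableP; split => //.
  under eq_integral do rewrite gee0_abs ?lee_fin //.
  (* Fatou's lemma bounds the integral of [x^(2n)] by the finite limit [c]. *)
  have := fatou mu measurableT mf (fun m x _ => _ : (0 <= (EFin \o f m) x)%E).
  move=> /(_ (fun m x => f0 m x)).
  rewrite (cvg_limn_einf_sup Iflim).1.
  under eq_integral do rewrite (cvg_limn_einf_sup (flim _)).1.
  by move=> /le_lt_trans; apply; rewrite ltry.
split=> //.
(* The dominating function is the limit [x^(2n)] itself, now known to be integrable. *)
have MXlim : (\int[mu]_x (f m x)%:E)%E @[m --> \oo] --> moment mu (2 * n).
  apply: (@dominated_cvg _ _ _ mu setT measurableT (fun m x => (f m x)%:E) _
    (fun x => (x ^+ (2 * n))%:E)) => //.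
  by move=> m x _; rewrite lee_fin ger0_norm.
exact: (cvg_unique _ MXlim Iflim).
Unshelve. all: by end_near.
Qed.

(** The functions [(2 - 2 cos (h x))^n sin (h x) / h^(2n+1)] tend to [x^(2n+1)] and are dominated by
    its absolute value, while their integrals are multiples of central differences of the zero
    function. *)
Lemma odd_moment_eq0 (R : realType)
    (mu : probability (measurableTypeR R) R) (n : nat) :
  (forall nu, \int[mu]_x sin (nu * x) = 0) -> moment_exists mu (2 * n.+1) ->
  moment_exists mu (2 * n).+1 /\ moment mu (2 * n).+1 = 0%E.
Proof.
move=> sin0 intX2.
have mX k : measurable_fun setT (fun x : measurableTypeR R => (x ^+ k)%:E).
  by apply/measurable_EFinP; exact: continuous_measurable_fun (@exprn_continuous R _).
have intX : moment_exists mu (2 * n).+1.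
  (* Integrability follows from [|x|^(2n+1) <= 1 + x^(2n+2)], checked separately for [|x| <= 1] and
     [|x| > 1]. *)
  have := integrableD measurableT (finite_measure_integrable_cst mu 1 measurableT) intX2.
  apply: le_integrable => // x _; rewrite /= lee_fin.
  rewrite [leRHS]ger0_norm; last by rewrite addr_ge0 // exprM exprn_ge0 // sqr_ge0.
  have -> : x ^+ (2 * n.+1) = `|x| ^+ (2 * n).+2.
    by rewrite (_ : (2 * n).+2 = 2 * n.+1)%N -?normrX ?ger0_norm //;
      [rewrite exprM exprn_ge0 // sqr_ge0|lia].
  rewrite normrX; have [x1|x1] := leP `|x| 1.
    by rewrite (@le_trans _ _ 1) ?exprn_ile1 // lerDl exprn_ge0.
  by rewrite (@le_trans _ _ (`|x| ^+ (2 * n).+2)) ?lerDr // ler_eXn2l.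
split=> //.
have hp m : 0 < harmonic m :> R by rewrite /= invr_gt0.
pose f (m : nat) (x : measurableTypeR R) : R :=
  (2 - 2 * cos (harmonic m * x)) ^+ n * sin (harmonic m * x).
pose c m : R := (harmonic m ^+ (2 * n).+1)^-1.
have cf m : continuous (f m).
  move=> x; apply: cvgM; first exact: continuous_expn_subr_2cos.
  exact: (@continuous_scale R sin _ (@continuous_sin R)).
have fX m x : `|c m * f m x| <= `|x ^+ (2 * n).+1|.
  have c0 : 0 < c m by rewrite invr_gt0 exprn_gt0.
  rewrite normrM (gtr0_norm c0) ler_pdivrMl ?exprn_gt0 //.
  rewrite -[X in X ^+ _ * _](ger0_norm (ltW (hp m))) -normrX -normrM -exprMn.
  rewrite /f !normrM exprSr normrM; apply: ler_pM => //; last exact: ler_norm_sin.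
  rewrite !normrX exprM lerXn2r ?nnegrE // real_normK ?num_real //.
  by rewrite ger0_norm ?subr_2cos_ge0 // subr_2cos_le.
have flimR x : c m * f m x @[m --> \oo] --> x ^+ (2 * n).+1.
  rewrite (_ : (fun m => _) = fun m =>
    ((2 - 2 * cos (harmonic m * x)) / harmonic m ^+ 2) ^+ n *
    (sin (harmonic m * x) / harmonic m)).
    rewrite exprSr exprM; apply: cvgM; last exact: cvg_sin_harmonic.
    apply: (@cvg_comp _ _ _ _ (fun y => y ^+ n)).
      exact: cvg_subr_2cos_harmonic.
    exact: exprn_continuous.
  apply/funext => m; rewrite /c /f; move: (harmonic m) => h.
  by rewrite exprSr exprM invfM expr_div_n; ring.
have flim x : (c m * f m x)%:E @[m --> \oo] --> (x ^+ (2 * n).+1)%:E.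
  by apply: cvg_EFin; [near=> m|exact: flimR].
have If m : (\int[mu]_x (c m * f m x)%:E)%E = 0%E.
  have intf : mu.-integrable setT (EFin \o f m).
    apply: (@integrable_bounded_continuous _ _ _ (4 ^+ n)) => // x.
    rewrite normrM -[leRHS]mulr1; apply: ler_pM => //; last exact: sin_max.
    rewrite normrX lerXn2r ?nnegrE // ger0_norm ?subr_2cos_ge0 //.
    by have := cos_geN1 (harmonic m * x); lra.
  under eq_integral do rewrite EFinM.
  rewrite integralZl //.
  (* The difference is taken at the point [nu = h], equal to the step, so that the factor
     [sin (h x)] appears. *)
  have := @iter_central_diff_Rintegral R mu sin (harmonic m) n (harmonic m).
  rewrite (funext sin0) iter_central_diff0 => /(_ (@continuous_sin R) (@sin_max R)) If0.
  rewrite -[X in (_ * X)%E]fineK; last exact: integrable_fin_num.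
  rewrite -[fine _]If0 ?mule0 // => a b.
  by rewrite sinB sinD; ring.
have Xlim : (\int[mu]_x (c m * f m x)%:E)%E @[m --> \oo] --> moment mu (2 * n).+1.
  apply: (@dominated_cvg _ _ _ mu setT measurableT (fun m x => (c m * f m x)%:E) _
    (fun x => `|x ^+ (2 * n).+1|%:E)) => //.
  - move=> m; apply/measurable_EFinP; apply: continuous_measurable_fun => x.
    by apply: cvgM; [exact: cvg_cst|exact: cf].
  - exact: integrable_norm intX.
  - by move=> m x _; rewrite lee_fin.
have lim0 : (\int[mu]_x (c m * f m x)%:E)%E @[m --> \oo] --> 0%E.
  by under eq_fun do rewrite If; exact: cvg_cst.
exact: (cvg_unique _ Xlim lim0).
Unshelve. all: by end_near.
Qed.

(** * Difference quotients of a function with an even Taylor expansion *)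

(** The differences kill the terms below [2n] and make the term of degree [2n] constant. The
    remainder is evaluated only within [n h] of 0, where it is of order [h^(2n+2)], so its quotient
    is of order [h^2]. *)
Lemma cvg_iter_central_diff (R : realType) (f : R -> R) (a : nat -> R) (C : R) (n : nat) :
  (forall nu, `|f nu - \sum_(j < n.+1) a j * nu ^+ (2 * j)| <= C * nu ^+ (2 * n.+1)) ->
  iter n (central_diff (harmonic m)) f 0 / harmonic m ^+ (2 * n) @[m --> \oo] -->
  (-1) ^+ n * (2 * n)`!%:R * a n.
Proof.
move=> fr; pose r nu := f nu - \sum_(j < n.+1) a j * nu ^+ (2 * j).
have C0 : 0 <= C.
  by have := le_trans (normr_ge0 _) (fr 1); rewrite expr1n mulr1.
have hp m : 0 < harmonic m :> R by rewrite /= invr_gt0.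
have split_f m : iter n (central_diff (harmonic m)) f 0 / harmonic m ^+ (2 * n) =
    (-1) ^+ n * (2 * n)`!%:R * a n +
    iter n (central_diff (harmonic m)) r 0 / harmonic m ^+ (2 * n).
  have -> : f = fun nu => \sum_(j < n.+1) a j * nu ^+ (2 * j) + r nu.
    by apply/funext => nu; rewrite /r subrKC.
  rewrite iter_central_diffD mulrDl; congr (_ + _).
    rewrite (iter_central_diff_sum _ _ (fun j : 'I_n.+1 => a j)
      (fun (j : 'I_n.+1) nu => nu ^+ (2 * j))).
    rewrite big_ord_recr /= big1 ?add0r => [|j _]; last first.
      rewrite iter_central_diffXn ?leq_pmul2l 1?ltnW // ifF ?mulr0 //.
      by apply/negbTE; rewrite eqn_pmul2l // ltn_eqF.
    rewrite iter_central_diffXn // eqxx.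
    by rewrite mulrA mulfK ?expf_neq0 ?gt_eqF // mulrC.
rewrite (funext split_f) -[X in _ --> X]addr0; apply: cvgD; first exact: cvg_cst.
(* The factor [4^n] is the growth under [n] differences; the power of [n] comes from
   [|y| <= n h]. *)
pose K := 4 ^+ n * (C * n%:R ^+ (2 * n.+1)).
have Klim : K * (harmonic m * harmonic m) @[m --> \oo] --> (0 : R).
  rewrite -(mulr0 K); apply: cvgM; first exact: cvg_cst.
  by rewrite -[X in _ --> X](mulr0 0); apply: cvgM; exact: cvg_harmonic.
have rK m : `|iter n (central_diff (harmonic m)) r 0 / harmonic m ^+ (2 * n)|
    <= K * (harmonic m * harmonic m).
  move: (harmonic m) (hp m) => h h0.
  rewrite normf_div [`|h ^+ _|]gtr0_norm ?exprn_gt0 // ler_pdivrMr ?exprn_gt0 //.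
  have -> : K * (h * h) * h ^+ (2 * n) = 4 ^+ n * (C * (n%:R * h) ^+ (2 * n.+1)).
    by rewrite /K exprMn mulnS !exprD; ring.
  apply: ler_norm_iter_central_diff; first exact: ltW.
  move=> y; rewrite subr0 => yh; rewrite (le_trans (fr y)) // ler_wpM2l //.
  rewrite !(exprM _ 2) -real_normK ?num_real // lerXn2r ?nnegrE ?sqr_ge0 //.
  by rewrite lerXn2r ?nnegrE // mulr_ge0 // ltW.
apply: (@squeeze_cvgr _ _ _ _ (fun m => - (K * (harmonic m * harmonic m)))
  (fun m => K * (harmonic m * harmonic m))) => //.
  by near=> m; rewrite -ler_norml.
by rewrite -oppr0; exact: cvgN.
Unshelve. all: by end_near.
Qed.

(** * Moments of the limiting distribution *)

Theorem mainTheorem5 (R : realType) (p q theta : R)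
    (mu : probability (measurableTypeR R) R)
    (hp0 : 0 < p) (hp1 : p < 1) (hq : q = 1 - p)
    (htheta0 : 0 <= theta) (htheta1 : theta < 2 * pi)
    (htheta : forall n : 'I_4, theta <> n%:R * pi / 2)
    (hmu : forall nu : R, charfun mu nu = Complex (phi q theta nu) 0) :
  forall n : nat,
    [/\ moment_exists mu (2 * n).+1,
        moment mu (2 * n).+1 = 0%E,
        moment_exists mu (2 * n) &
        moment mu (2 * n) =
          ((2 * n)`!%:R / (n`!%:R * 2 ^+ n)
           * (cot theta ^+ 2 / (1 - q ^+ 2)) ^+ n
           * T_poly n q)%:E].
Proof.
have cosE nu : \int[mu]_x cos (nu * x) = phi q theta nu.
  by have [] := hmu nu.
have sinE nu : \int[mu]_x sin (nu * x) = 0.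
  by have [] := hmu nu.
have q2 : 0 < 1 - q ^+ 2 by rewrite hq; nra.
(* The exponent of [phi] is [- b k * nu^2]; [w] collects its factors independent of [k], including
   the 1/2. *)
pose w : R := cot theta ^+ 2 / (1 - q ^+ 2) / 2.
have w0 : 0 <= w by rewrite divr_ge0 // divr_ge0 ?sqr_ge0 // ltW.
pose b k := w * (1 + 2 * q * cos k + q ^+ 2).
have b0 k : 0 <= b k.
  rewrite /b mulr_ge0 //.
  have -> : 1 + 2 * q * cos k + q ^+ 2 = (1 - q) ^+ 2 + 2 * (q * (1 + cos k)) by ring.
  rewrite addr_ge0 ?sqr_ge0 // mulr_ge0 // mulr_ge0 ?hq; have := cos_geN1 k; lra.
have cp : continuous (fun k : R => 1 + 2 * q * cos k + q ^+ 2).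
  move=> k; apply: cvgD; last exact: cvg_cst.
  apply: cvgD; first exact: cvg_cst.
  by apply: cvgM; [exact: cvg_cst|exact: continuous_cos].
have cb : continuous b.
  by move=> k; apply: cvgM; [exact: cvg_cst|exact: cp].
have phiE nu : phi q theta nu = circle_mean (fun k => expR (- (b k * nu ^+ 2))).
  by congr (_ * _); apply: eq_Rintegral => k _; congr expR; rewrite /b /w; ring.
have bX j : circle_mean (fun k => b k ^+ j) = w ^+ j * T_poly j q.
  rewrite -circle_mean_poisson_factor -circle_meanZl.
    by congr circle_mean; apply/funext => k; rewrite exprMn.
  by move=> k; exact: (continuous_comp (cp k) (@exprn_continuous R j _)).
have even n : moment_exists mu (2 * n) /\ moment mu (2 * n) =
    ((2 * n)`!%:R / (n`!%:R * 2 ^+ n) * (cot theta ^+ 2 / (1 - q ^+ 2)) ^+ n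
     * T_poly n q)%:E.
  apply: even_moment_of_central_diff; rewrite (funext cosE).
  (* The coefficient of [nu^(2j)] in the expansion of [phi] at 0. *)
  pose a j := (-1) ^+ j * (circle_mean (fun k => b k ^+ j) / j`!%:R).
  (* The sign of [a n] cancels that of the central difference, and [w^n] contributes the factor
     [1 / 2^n]. *)
  rewrite (_ : _ * _ * _ = (-1) ^+ n * (2 * n)`!%:R * a n); last first.
    rewrite /a bX /w; move: (_ / (1 - _)) => A.
    by rewrite expr_div_n invfM -[LHS]mul1r -[X in X * _ = _](sqrr_sign R n); ring.
  apply: (@cvg_iter_central_diff _ _ a
    (circle_mean (fun k => b k ^+ n.+1) / n.+1`!%:R)) => nu.
  have [r rC] := circle_mean_expR n.+1 nu cb b0; rewrite -phiE => ->.
  by rewrite addrAC subrr add0r.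
move=> n; have [intE momE] := even n.
(* The odd moment of order [2n + 1] is controlled by the even one of order [2n + 2]. *)
by have [intO momO] := odd_moment_eq0 sinE (even n.+1).1.
Qed.
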